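(* Let $E$ be a uniformly convex real Banach space whose norm is uniformly Gâteaux differentiable. Let $C$ be a nonempty closed convex subset of $E$, $\{S_n\}_{n\in\mathbb N}$ a sequence of self-mappings of $C$, $T\colon C\to C$ a nonexpansive mapping, $\{\alpha_n\}_{n\in\mathbb N}$ a sequence in $(0,1]$, $u$ a point in $C$, and $\{x_n\}$ the sequence defined by $x_1\in C$ (arbitrary) and $$x_{n+1}=\alpha_n u+(1-\alpha_n)S_nx_n\qquad (n\in\mathbb N).$$ Suppose that $\alpha_n\to 0$, $\sum_{n=1}^\infty\alpha_n=\infty$, $\{S_n\}$ is a strongly nonexpansive sequence, and $\{S_n\}$ satisfies the NST condition (I) with $T$. Then $\{x_n\}$ converges strongly (i.e. in norm) to $Qu$, where $Q$ is the sunny nonexpansive retraction of $C$ onto $\mathrm{F}(T)$.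
   Context: $\mathbb N$ is the set of positive integers. For a mapping $T\colon C\to E$ with $C\subset E$, $\mathrm F(T)=\{x\in C: Tx=x\}$; for a sequence $\{S_n\}$ of mappings $C\to E$, $\mathrm F(\{S_n\})=\bigcap_{n=1}^\infty \mathrm F(S_n)$. $T$ is nonexpansive if $\|Tx-Ty\|\le\|x-y\|$ for all $x,y\in C$. With $U_E=\{x\in E:\|x\|=1\}$: the norm of $E$ is uniformly Gâteaux differentiable if for each $y\in U_E$ the limit $\lim_{t\to0}(\|x+ty\|-\|x\|)/t$ exists for all $x\in U_E$ and is attained uniformly for $x\in U_E$; $E$ is uniformly convex if for any $\epsilon>0$ there exists $\delta>0$ such that $x,y\in U_E$ and $\|x-y\|\ge\epsilon$ imply $\|x+y\|/2\le1-\delta$. $\{S_n\}$ (mappings $C\to E$) is a strongly nonexpansive sequence if each $S_n$ is nonexpansive and $x_n-y_n-(S_nx_n-S_ny_n)\to0$ whenever $\{x_n\},\{y_n\}$ are sequences in $C$ such that $\{x_n-y_n\}$ is bounded and $\|x_n-y_n\|-\|S_nx_n-S_ny_n\|\to0$. $\{S_n\}$ satisfies the NST condition (I) with a mapping $T\colon C\to E$ if $\mathrm F(\{S_n\})\neq\emptyset$, $\mathrm F(T)\subset\mathrm F(\{S_n\})$, and $x_n-Tx_n\to0$ whenever $\{x_n\}$ is a bounded sequence in $C$ with $x_n-S_nx_n\to0$. (This forces $\mathrm F(T)=\mathrm F(\{S_n\})$.) For nonempty $K\subset C$, a mapping $Q$ of $C$ onto $K$ is a retraction if $Qx=x$ for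 all $x\in K$; it is sunny if $Q(Qx+\lambda(x-Qx))=Qx$ whenever $x\in C$, $\lambda\ge0$ and $Qx+\lambda(x-Qx)\in C$. A sunny nonexpansive retraction is a retraction that is sunny and nonexpansive. It is known that, when $E$ is a uniformly convex real Banach space whose norm is uniformly Gâteaux differentiable and $C$ is a nonempty closed convex subset of $E$, for a nonexpansive self-mapping $T$ of $C$ with $\mathrm F(T)\ne\emptyset$ there is a unique sunny nonexpansive retraction of $C$ onto $\mathrm F(T)$. *)

(* Defs.v *)
From HB Require Import structures.
From mathcomp Require Import all_boot all_order all_algebra.
From mathcomp Require Import all_classical all_reals all_analysis.

Set Implicit Arguments.
Unset Strict Implicit.
Unset Printing Implicit Defensive.

Import Order.TTheory GRing.Theory Num.Theory.
Import numFieldNormedType.Exports.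

Local Open Scope classical_set_scope.
Local Open Scope ring_scope.

(* A mapping from a subset C of E to E is a total function E -> E of which only
   the values on C are used: every definition below is relativized to C.
   Sequences are indexed from 0, so that [S 0] stands for S_1, and so on. *)

Definition unit_sphere (R : realType) (E : normedModType R) : set E :=
  [set x | `|x| = 1].

Definition uniformly_gateaux_differentiable_norm
    (R : realType) (E : normedModType R) : Prop :=
  forall y : E, unit_sphere y ->
  exists l : E -> R,
    (forall x : E, unit_sphere x ->
       (`|x + t *: y| - `|x|) / t @[t --> (0 : R)^'] --> l x) /\
    (forall e : R, 0 < e ->
       \forall t \near (0 : R)^', forall x : E, unit_sphere x ->
         `|(`|x + t *: y| - `|x|) / t - l x| < e).

Definition uniformly_convex (R : realType) (E : normedModType R) : Prop :=
  forall e : R, 0 < e ->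
  exists2 d : R, 0 < d &
    forall x y : E, unit_sphere x -> unit_sphere y ->
      e <= `|x - y| -> `|x + y| / 2 <= 1 - d.

Definition fixed_points (R : realType) (E : normedModType R)
    (C : set E) (T : E -> E) : set E :=
  [set x | C x /\ T x = x].

Definition common_fixed_points (R : realType) (E : normedModType R)
    (C : set E) (S : nat -> E -> E) : set E :=
  \bigcap_n fixed_points C (S n).

Definition nonexpansive (R : realType) (E : normedModType R)
    (C : set E) (T : E -> E) : Prop :=
  forall x y : E, C x -> C y -> `|T x - T y| <= `|x - y|.

Definition strongly_nonexpansive_sequence (R : realType) (E : normedModType R)
    (C : set E) (S : nat -> E -> E) : Prop :=
  (forall n, nonexpansive C (S n)) /\
  (forall x y : nat -> E,
    (forall n, C (x n)) -> (forall n, C (y n)) ->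
    bounded_fun (fun n => x n - y n) ->
    `|x n - y n| - `|S n (x n) - S n (y n)| @[n --> \oo] --> (0 : R) ->
    x n - y n - (S n (x n) - S n (y n)) @[n --> \oo] --> (0 : E)).

Definition NST_condition_I (R : realType) (E : normedModType R)
    (C : set E) (S : nat -> E -> E) (T : E -> E) : Prop :=
  [/\ common_fixed_points C S !=set0,
      fixed_points C T `<=` common_fixed_points C S
    & forall x : nat -> E,
        (forall n, C (x n)) -> bounded_fun x ->
        x n - S n (x n) @[n --> \oo] --> (0 : E) ->
        x n - T (x n) @[n --> \oo] --> (0 : E)].

Definition retraction (R : realType) (E : normedModType R)
    (C K : set E) (Q : E -> E) : Prop :=
  Q @` C = K /\ forall x : E, K x -> Q x = x.

Definition sunny (R : realType) (E : normedModType R)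
    (C : set E) (Q : E -> E) : Prop :=
  forall (x : E) (l : R), C x -> 0 <= l ->
    C (Q x + l *: (x - Q x)) -> Q (Q x + l *: (x - Q x)) = Q x.

Definition sunny_nonexpansive_retraction (R : realType) (E : normedModType R)
    (C K : set E) (Q : E -> E) : Prop :=
  [/\ retraction C K Q, sunny C Q & nonexpansive C Q].

(* Main.v *)
Require Import Defs.
From HB Require Import structures.
From mathcomp Require Import all_boot all_order all_algebra.
From mathcomp Require Import all_classical all_reals all_analysis.
From mathcomp Require Import ring lra.

Set Implicit Arguments.
Unset Strict Implicit.
Unset Printing Implicit Defensive.

Import Order.TTheory GRing.Theory Num.Theory.
Import numFieldNormedType.Exports.

Local Open Scope classical_set_scope.
Local Open Scope ring_scope.

(* Directional derivatives of [v |-> `|v| ^ 2] replace duality maps throughout: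
   they are bracketed by difference quotients, which are monotone in the step by
   convexity and, when the norm is uniformly Gateaux differentiable, differ by
   little for a small step of either sign, uniformly on bounded sets.

   Let [q = Q u] and let [z_t] solve [z = t u + (1 - t) T z].  The asymptotic
   center of the [z_t] as [t -> 0] is fixed by [T], is a cluster point of the
   [z_t], and equals [q] because [Q] is sunny.  Comparing with a [z_t] close to
   [q] shows that the derivative at [x - q] in the direction [u - q] is almost
   nonpositive whenever [x - T x] is small.  Finally, at each large [n], either
   [|x_n - q| - |S_n x_n - q|] is bounded below, and [|x_n - q|] drops by a fixed
   amount, or [x_(n+1)] is an approximate fixed point of [T]; in both cases
   [|x_(n+1) - q|^2 <= (1 - alpha_n) |x_n - q|^2 + alpha_n e]. *)

(** * Convexity and smoothness of the squared norm *)

Lemma sqr_convex_comb (R : realFieldType) (a s x y z : R) :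
  0 < a -> 0 < s -> 0 <= x -> (s + a) * x <= a * y + s * z ->
  (s + a) * x ^+ 2 <= a * y ^+ 2 + s * z ^+ 2.
Proof.
move=> a0 s0 x0 h; have sa0 : 0 < s + a by lra.
rewrite -(ler_pM2l sa0).
have h1 : ((s + a) * x) ^+ 2 <= (a * y + s * z) ^+ 2.
  rewrite ler_sqr ?nnegrE//; first by apply: mulr_ge0; lra.
  by apply: le_trans h; apply: mulr_ge0; lra.
have h2 : 0 <= (a * s) * (y - z) ^+ 2 by rewrite mulr_ge0 ?sqr_ge0// mulr_ge0 ?ltW.
have e1 : (s + a) * ((s + a) * x ^+ 2) = ((s + a) * x) ^+ 2 by ring.
have e2 : (s + a) * (a * y ^+ 2 + s * z ^+ 2) =
  (a * y + s * z) ^+ 2 + (a * s) * (y - z) ^+ 2 by ring.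
rewrite e1 e2; lra.
Qed.

Section normed.
Context (R : realType) (E : normedModType R).
Implicit Types (v w x y z u : E) (a s t : R) (C : set E).

Lemma norm_between v w a s : 0 < a -> 0 < s ->
  (s + a) * `|v| <= a * `|v + s *: w| + s * `|v - a *: w|.
Proof.
move=> a0 s0; have sa0 : 0 < s + a by lra.
have -> : (s + a) * `|v| = `|a *: (v + s *: w) + s *: (v - a *: w)|.
  rewrite scalerDr scalerBr !scalerA addrACA (mulrC s a) subrr addr0 -scalerDl.
  by rewrite normrZ gtr0_norm (addrC a).
by apply: le_trans (ler_normD _ _) _; rewrite !normrZ !gtr0_norm.
Qed.

(** As [v] is a convex combination of [v + s *: w] and [v - a *: w], the backward difference
    quotient of the squared norm with step [a] lies below the forward one with step [s]. *)
Lemma norm_between_sqr v w a s : 0 < a -> 0 < s ->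
  (s + a) * `|v| ^+ 2 <= a * `|v + s *: w| ^+ 2 + s * `|v - a *: w| ^+ 2.
Proof. by move=> a0 s0; apply: sqr_convex_comb => //; exact: norm_between. Qed.

Lemma convex_setP C : convex_set C <-> forall x y s, C x -> C y -> 0 <= s <= 1 ->
  C (s *: x + (1 - s) *: y).
Proof.
split=> [cC x y s Cx Cy s01|cC x y l].
  have := cC x y (Itv01 (proj1 (andP s01)) (proj2 (andP s01))).
  by rewrite !inE => /(_ Cx Cy).
by rewrite !inE => Cx Cy; apply: cC => //; apply/andP; split.
Qed.

(* The defining inequality is only available on the sphere, so vectors of norm
   at least [1 - k] are normalised, with [k] small with respect to [e] and to
   the modulus at [e / 2]; otherwise the bound is immediate. *)
Lemma uniformly_convex_ball : uniformly_convex E ->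
  forall e, 0 < e -> exists2 d, 0 < d & forall r x y, 0 < r ->
    `|x| <= r -> `|y| <= r -> e * r <= `|x - y| -> `|x + y| <= 2 * (r * (1 - d)).
Proof.
move=> uc e e0.
have [d d0 hd] := uc (e / 2) ltac:(lra).
pose k := Num.min (e / 4) (Num.min (d / 2) (1 / 2)).
have [k0 ke kd kh] : [/\ 0 < k, k <= e / 4, k <= d / 2 & k <= 1 / 2].
  rewrite /k; split; last by rewrite !ge_min lexx !orbT.
  - by rewrite !lt_min; apply/andP; split; [lra|apply/andP; split; lra].
  - by rewrite !ge_min lexx.
  - by rewrite !ge_min lexx !orbT.
exists (k / 2); first lra.
suff H x y : `|x| <= 1 -> `|y| <= 1 -> e <= `|x - y| -> `|x + y| <= 2 * (1 - k / 2).
  move=> r x y r0 xr yr exy.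
  have := H (r^-1 *: x) (r^-1 *: y).
  rewrite -scalerBr -scalerDr !normrZ gtr0_norm ?invr_gt0//.
  rewrite ![r^-1 * _]mulrC !ler_pdivrMr// ler_pdivlMr// !mul1r => /(_ xr yr exy).
  by rewrite -mulrA (mulrC _ r).
move=> x1 y1 exy.
have [xk|xk] := leP `|x| (1 - k).
  by apply: le_trans (ler_normD _ _) _; lra.
have [yk|yk] := leP `|y| (1 - k).
  by apply: le_trans (ler_normD _ _) _; lra.
have nrm z : 1 - k < `|z| -> `|z| <= 1 ->
    `|(`|z|)^-1 *: z| = 1 /\ `|z - (`|z|)^-1 *: z| <= k.
  move=> zk z1; have z0 : 0 < `|z| by lra.
  split; first by rewrite normrZ normfV normr_id mulVf// gt_eqF.
  have -> : z - (`|z|)^-1 *: z = (1 - (`|z|)^-1) *: z by rewrite scalerBl scale1r.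
  rewrite normrZ ler0_norm; last by rewrite subr_le0 invf_ge1.
  by rewrite opprB mulrBl mulVf ?gt_eqF// mul1r; lra.
have [nx kx] := nrm x xk x1; have [ny ky] := nrm y yk y1.
set x' := _ *: x in nx kx; set y' := _ *: y in ny ky.
have dx : `|x - y| <= `|x' - y'| + 2 * k.
  have := ler_distD x' x y; have := ler_distD y' x' y.
  by rewrite (distrC y' y); lra.
have := hd x' y' nx ny ltac:(lra).
have : `|x + y| <= `|x' + y'| + 2 * k.
  have -> : x + y = (x' + y') + ((x - x') + (y - y')).
    by rewrite addrACA !subrKC.
  apply: le_trans (ler_normD _ _) _; rewrite lerD2l.
  by apply: le_trans (ler_normD _ _) _; lra.
move=> h1; rewrite ler_pdivrMr//; lra.
Qed.

(** Differentiability is uniform only over the sphere, so long vectors are normalised; for short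
    ones the triangle inequality suffices. This is what lets forward and backward quotients at step
    [s] be exchanged at the cost of [e]. *)
Lemma uniformly_gateaux_sqr : uniformly_gateaux_differentiable_norm E ->
  forall w M e, 0 < M -> 0 < e -> exists2 s, 0 < s <= 1 &
    forall v, `|v| <= M ->
      `|v + s *: w| ^+ 2 + `|v - s *: w| ^+ 2 <= 2 * `|v| ^+ 2 + s * e.
Proof.
move=> ug w M e M0 e0.
have [->|w0] := eqVneq w 0.
  exists 1; first by rewrite ltr01 lexx.
  by move=> v _; rewrite scaler0 addr0 subr0; lra.
pose W := `|w|; have W0 : 0 < W by rewrite normr_gt0.
pose y := W^-1 *: w.
have y1 : unit_sphere y.
  by rewrite /unit_sphere/= normrZ normfV normr_id mulVf// gt_eqF.
have wy : w = W *: y by rewrite scalerA mulfV ?scale1r// gt_eqF.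
have [l [_ hl]] := ug y y1.
(* [k] keeps the first-order error below half of [s * e], [b1] does so for the second-order one, and
   [b2] keeps the normalised step [s * W / r] below [tau] when [r > k * M]. *)
pose k := e / (8 * M * W).
have k0 : 0 < k by rewrite divr_gt0// !mulr_gt0.
have kE : 8 * M * W * k = e by rewrite mulrCA mulfV ?mulr1// gt_eqF// !mulr_gt0.
have /nbhs_ballP[tau /= tau0 htau] := hl k k0.
pose b1 := e / (8 * W ^+ 2 * (k ^+ 2 + 1)).
have D0 : 0 < 8 * W ^+ 2 * (k ^+ 2 + 1).
  by rewrite !mulr_gt0 ?exprn_gt0// addr_gt0 ?exprn_gt0.
have b10 : 0 < b1 by rewrite divr_gt0.
pose b2 := tau * k * M / (2 * W).
have b20 : 0 < b2 by rewrite !(divr_gt0, mulr_gt0).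
pose s := Num.min 1 (Num.min b1 b2).
have [s0 s1 sb1 sb2] : [/\ 0 < s, s <= 1, s <= b1 & s <= b2].
  by rewrite /s; split; rewrite ?lt_min ?ltr01 ?b10 ?b20 // !ge_min lexx ?orbT.
exists s; first by rewrite s0.
move=> v vM.
set p := `|v + s *: w|; set q := `|v - s *: w|; set r := `|v|.
have r0 : 0 <= r by exact: normr_ge0.
have nsw : `|s *: w| = s * W by rewrite normrZ gtr0_norm.
have sW0 : 0 < s * W by rewrite mulr_gt0.
have p0 : 0 <= p by exact: normr_ge0.
have q0 : 0 <= q by exact: normr_ge0.
have pq : `|p - q| <= 2 * (s * W).
  apply: le_trans (ler_dist_dist _ _) _.
  rewrite opprB addrC addrA subrK -nsw.
  by apply: le_trans (ler_normD _ _) _; lra.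
have pq2 : (p - q) ^+ 2 <= 4 * (s * W) ^+ 2.
  rewrite -real_normK ?num_real//.
  have := ler_pM (normr_ge0 _) (normr_ge0 _) pq pq; rewrite -!expr2; lra.
have second_order : 4 * ((s * W) ^+ 2 * (k ^+ 2 + 1)) <= s * e / 2.
  move: sb1; rewrite ler_pdivlMr// => /(ler_wpM2l (ltW s0)); nra.
have first_order : 8 * M * k * (s * W) = s * e by rewrite -kE; ring.
have kk0 : 0 <= (s * W) ^+ 2 * k ^+ 2 by rewrite mulr_ge0 ?sqr_ge0.
(* Since [(p - q) ^+ 2] is already of second order in [s], only [p + q] remains to be bounded. *)
have sum_sqr : p ^+ 2 + q ^+ 2 = ((p + q) ^+ 2 + (p - q) ^+ 2) / 2 by field.
have [rM|rM] := leP r (k * M).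
  have pqD : p + q <= 2 * r + 2 * (s * W).
    have := ler_normD v (s *: w); have := ler_normB v (s *: w).
    by rewrite nsw -/p -/q -/r; lra.
  have := ler_pM (addr_ge0 p0 q0) (addr_ge0 p0 q0) pqD pqD; rewrite -expr2.
  have := ler_wpM2r (ltW sW0) rM.
  rewrite sum_sqr; nra.
have rp : 0 < r by apply: lt_trans rM; rewrite mulr_gt0.
(* [v + s *: w] is [r] times [x + h *: y]; the derivative [l x] cancels when the estimates for the
   steps [h] and [- h] are added. *)
pose x := r^-1 *: v; pose h := s * W / r.
have x1 : unit_sphere x by rewrite /unit_sphere/= normrZ normfV normr_id mulVf// gt_eqF.
have vx : v = r *: x by rewrite scalerA mulfV ?scale1r// gt_eqF.
have swy : s *: w = r *: (h *: y).
  by rewrite scalerA /h wy scalerA mulrCA mulfV ?mulr1// gt_eqF.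
have h0 : 0 < h by rewrite divr_gt0.
have hr : h * r = s * W by rewrite divfK// gt_eqF.
have htau' : h < tau.
  rewrite ltr_pdivrMr//.
  have : s * (2 * W) <= tau * k * M by rewrite -ler_pdivlMr// mulr_gt0.
  have : tau * (k * M) < tau * r by rewrite ltr_pM2l.
  by nra.
have xE : `|x| = 1 by [].
have ph : `|x + h *: y| <= 1 + h * l x + h * k.
  have hb : ball (0 : R) tau h by rewrite -ball_normE/= sub0r normrN gtr0_norm.
  have := htau h hb (lt0r_neq0 h0) x x1; rewrite xE ltr_norml => /andP[_].
  rewrite ltrBlDr ltr_pdivrMr//; nra.
have qh : `|x - h *: y| <= 1 - h * l x + h * k.
  have hb : ball (0 : R) tau (- h) by rewrite -ball_normE/= sub0r opprK gtr0_norm.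
  have hN0 : - h != 0 by rewrite oppr_eq0 lt0r_neq0.
  have := htau (- h) hb hN0 x x1; rewrite xE ltr_norml scaleNr => /andP[+ _].
  rewrite invrN mulrN ltrBrDr ltrNr ltr_pdivrMr//; nra.
have pqD : p + q <= 2 * r + 2 * (s * W) * k.
  rewrite /p /q swy {1 2}vx -scalerDr -scalerBr !normrZ gtr0_norm// -mulrDr.
  have := ler_wpM2l (ltW rp) (lerD ph qh); rewrite -hr; lra.
have := ler_pM (addr_ge0 p0 q0) (addr_ge0 p0 q0) pqD pqD; rewrite -expr2.
have := ler_wpM2r (ltW sW0) (ler_wpM2r (ltW k0) vM).
rewrite -/r sum_sqr; nra.
Qed.
End normed.

(** * Asymptotic centers, resolvents and sunny retractions *)

Section asymptotic_center.
Context (R : realType) (E : completeNormedModType R).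
Implicit Types (x y p u : E) (e k r t : R).

(* [p] minimises [limsup_n `|z n - y|] over [y] in [C]; the minimum is [rho]. *)
Lemma asymptotic_center (C : set E) (z : nat -> E) c r :
  uniformly_convex E -> closed C -> convex_set C -> C c ->
  (\forall n \near \oo, `|z n - c| <= r) ->
  exists rho p, [/\ C p,
    forall k, 0 < k -> \forall n \near \oo, `|z n - p| <= rho + k,
    forall y s, C y -> s < rho -> ~ \forall n \near \oo, `|z n - y| <= s &
    forall y, C y -> (forall k, 0 < k -> \forall n \near \oo, `|z n - y| <= rho + k) ->
      y = p].
Proof.
move=> uc Ccl /convex_setP Ccv Cc zr.
pose A := [set s | exists2 y, C y & \forall n \near \oo, `|z n - y| <= s].
have A0 : A r by exists c.
have Alb : lbound A 0.
  by move=> s [y _ /filter_ex[n]]; apply: le_trans; exact: normr_ge0.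
pose rho := inf A.
have rho0 : 0 <= rho by apply: lb_le_inf => //; exists r.
have rhoA s : A s -> rho <= s by apply: ge_inf; exists 0.
(* Almost minimal points are close to each other, since otherwise their midpoint would beat the
   infimum [rho]. This yields both the convergence of a minimising sequence and uniqueness. *)
have key e : 0 < e -> exists2 k, 0 < k & forall y y', C y -> C y' ->
    (\forall n \near \oo, `|z n - y| <= rho + k) ->
    (\forall n \near \oo, `|z n - y'| <= rho + k) -> `|y - y'| < e.
  move=> e0.
  have [rho_eq0|rho_neq0] := eqVneq rho 0.
    exists (e / 3); first lra.
    move=> y y' _ _ zy zy'.
    have [n [zny zny']] := filter_ex (filterI zy zy').
    by have := ler_distD (z n) y y'; rewrite (distrC y (z n)); lra.
  have rho_gt0 : 0 < rho by rewrite lt0r rho_neq0.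
  have e'0 : 0 < e / (2 * rho) by rewrite divr_gt0// mulr_gt0.
  have [d d0 hd] := uniformly_convex_ball uc e'0.
  (* The midpoint gets the bound [rho * (1 + m) * (1 - d)], at most [rho * (1 - m ^+ 2)], hence
     below [rho]. *)
  pose m := Num.min 1 d.
  have m0 : 0 < m by rewrite lt_min ltr01.
  have m1 : m <= 1 by rewrite ge_min lexx.
  have md : m <= d by rewrite ge_min lexx orbT.
  exists (rho * m); first by rewrite mulr_gt0.
  move=> y y' Cy Cy' zy zy'; rewrite ltNge; apply/negP => eyy'.
  pose s := rho + rho * m.
  have s0 : 0 < s by rewrite addr_gt0// mulr_gt0.
  have es : e / (2 * rho) * s <= `|y - y'|.
    apply: le_trans eyy'; rewrite mulrAC ler_pdivrMr ?mulr_gt0//.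
    by rewrite ler_pM2l// /s; nra.
  have : A (s * (1 - d)).
    exists (2^-1 *: y + (1 - 2^-1) *: y'); first by apply: Ccv => //; lra.
    near=> n.
    have -> : z n - (2^-1 *: y + (1 - 2^-1) *: y') = 2^-1 *: ((z n - y) + (z n - y')).
      have half : 1 - 2^-1 = 2^-1 :> R by field.
      rewrite half -scalerDr addrACA -opprD scalerBr; congr (_ - _).
      by rewrite scalerDr -scalerDl -[in LHS](scale1r (z n)); congr (_ *: _); field.
    rewrite normrZ gtr0_norm// mulrC ler_pdivrMr// mulrC.
    apply: hd => //; [by near: n|by near: n|].
    by rewrite opprB [X in `|X|]addrC addrA subrK distrC.
  move=> /rhoA; rewrite /s => h.
  have : rho * (1 + m) * (1 - d) <= rho * (1 + m) * (1 - m).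
    by rewrite ler_pM2l ?mulr_gt0 ?addr_gt0// lerD2l lerN2.
  by have := mulr_gt0 rho_gt0 (mulr_gt0 m0 m0); nra.
have /choice[y hy] : forall i, exists y, C y /\
    \forall n \near \oo, `|z n - y| <= rho + i.+1%:R^-1.
  move=> i.
  have [||s [y Cy zy] srho] := @inf_adherent _ A i.+1%:R^-1.
  - by rewrite invr_gt0.
  - by split; [exists r|exists 0].
  exists y; split => //; near=> n.
  by apply: (le_trans _ (ltW srho)); near: n.
have hyk i k : i.+1%:R^-1 < k -> \forall n \near \oo, `|z n - y i| <= rho + k.
  move=> ik; near=> n; apply: (@le_trans _ _ (rho + i.+1%:R^-1)).
    by near: n; exact: (hy i).2.
  by rewrite lerD2l ltW.
have : cvg (y @ \oo).
  apply: cauchy_cvg; apply: cauchy_exP => e e0.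
  have [k k0 hk] := key e e0.
  have [N _ HN] := near_infty_natSinv_lt (PosNum k0).
  exists (y N); exists N => // i /= Ni; rewrite -ball_normE/=.
  by apply: hk; [exact: (hy N).1|exact: (hy i).1|apply/hyk/HN => /=|apply/hyk/HN].
move=> /cvg_ex[p yp].
have Cp : C p by apply: (closed_cvg _ Ccl _ _ yp); near=> i; exact: (hy i).1.
have zp k : 0 < k -> \forall n \near \oo, `|z n - p| <= rho + k.
  move=> k0.
  have k20 : 0 < k / 2 by lra.
  near \oo => i.
  have yip : `|y i - p| <= k / 2.
    by near: i; move/cvgrPdistC_le : yp; exact.
  have := hyk i (k / 2) _.
  have ik : i.+1%:R^-1 < k / 2 by near: i; exact: (near_infty_natSinv_lt (PosNum k20)).
  move=> /(_ ik) ziy; near=> n.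
  have : `|z n - y i| <= rho + k / 2 by near: n.
  by have := ler_distD (y i) (z n) p; lra.
exists rho, p; split=> // [y' s Cy' srho zy'|y' Cy' zy'].
  by have := rhoA s (ex_intro2 _ _ y' Cy' zy'); lra.
apply/eqP; rewrite -subr_eq0 -normr_le0; apply/ler_addgt0Pr => e e0; rewrite add0r.
by have [k k0 hk] := key e e0; apply/ltW/hk => //; [exact: zy'|exact: zp].
Unshelve. all: by end_near. Qed.

(** Banach's fixed point theorem: the right-hand side, as a function of [z], is a contraction of [C]
    with factor [1 - t]. *)
Lemma resolvent_exists (C : set E) (T : E -> E) u t :
  closed C -> convex_set C -> set_fun C C T -> nonexpansive C T -> C u ->
  0 < t <= 1 -> exists2 z, C z & z = t *: u + (1 - t) *: T z.
Proof.
move=> Ccl /convex_setP Ccv CT Tne Cu /andP[t0 t1].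
have fC : set_fun C C (fun z => t *: u + (1 - t) *: T z).
  by move=> z Cz; apply: Ccv => //; [exact: CT|rewrite ltW].
have q0 : 0 <= 1 - t by lra.
apply: (@banach_fixed_point _ _ C (mkfun fC)) => //; last by exists u.
exists (NngNum q0); split => /=; first by lra.
move=> [a b] /= [Ca Cb]; rewrite /mkfun.
by rewrite opprD addrACA subrr add0r -scalerBr normrZ ger0_norm// ler_wpM2l// Tne.
Qed.
End asymptotic_center.

(** Going back from [z - y] by [t *: (u - y)] gives [(1 - t) *: (T z - y)], which shortens the norm
    by at least a factor [1 - t]; by convexity the norm grows at least at the same rate forward. *)
Lemma resolvent_expansive (R : realType) (E : normedModType R) (C : set E)
    (T : E -> E) (u z y : E) (t s : R) :
  nonexpansive C T -> fixed_points C T y -> C z -> 0 < t <= 1 ->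
  z = t *: u + (1 - t) *: T z -> 0 < s ->
  (1 + s) * `|z - y| <= `|z - y + s *: (u - y)|.
Proof.
move=> Tne [Cy Ty] Cz /andP[t0 t1] zE s0.
have := norm_between (z - y) (u - y) t0 s0.
have -> : z - y - t *: (u - y) = (1 - t) *: (T z - y).
  rewrite [in LHS]zE !scalerBr opprB -!addrA [LHS]addrC !addrA subrK.
  by rewrite (scalerBl _ _ y) scale1r opprB -!addrA (addrC (- y)).
rewrite normrZ ger0_norm; last lra.
have : (1 - t) * `|T z - y| <= (1 - t) * `|z - y|.
  by rewrite ler_wpM2l; [|lra|rewrite -[in leLHS]Ty Tne].
move=> /(ler_wpM2l (ltW s0)) h1 h2.
by rewrite -(ler_pM2l t0); lra.
Qed.

(** Every point of the segment from [Q u] to [u] retracts to [Q u], while [y] is fixed, so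
    nonexpansiveness compares the two distances. It stands for the inequality <u - Q u, J (y - Q u)>
    <= 0 with the duality map J. *)
Lemma sunny_variational (R : realType) (E : normedModType R) (C K : set E)
    (Q : E -> E) (u y : E) (s : R) :
  convex_set C -> K `<=` C -> sunny_nonexpansive_retraction C K Q ->
  C u -> K y -> 0 <= s <= 1 ->
  `|y - Q u| <= `|y - Q u - s *: (u - Q u)|.
Proof.
move=> /convex_setP Ccv KC [[QK Qid] Qs Qne] Cu Ky /andP[s0 s1].
have CQu : C (Q u) by apply: KC; rewrite -QK; exists u.
have Cs : C (Q u + s *: (u - Q u)).
  have := Ccv u (Q u) s Cu CQu; rewrite s0 s1 => /(_ isT).
  by rewrite scalerBl scale1r scalerBr addrCA.
rewrite -addrA -opprD (distrC y) (distrC y) -{1}(Qs _ _ Cu s0 Cs) -{1}(Qid _ Ky).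
by apply: Qne => //; exact: KC.
Qed.

(** * Approximation of [Q u] by resolvents *)

Section retraction.
Context (R : realType) (E : completeNormedModType R).
Hypotheses (E_uc : uniformly_convex E)
  (E_ug : uniformly_gateaux_differentiable_norm E).
Context (C : set E) (T : E -> E) (u : E).
Hypotheses (C_closed : closed C) (C_convex : convex_set C)
  (T_self : set_fun C C T) (T_ne : nonexpansive C T) (Cu : C u).

(* Reich's theorem, for a cluster point only: the asymptotic center [p] of the
   resolvents is fixed by [T], its minimality along the segment [p, u] makes it
   a cluster point, and [p = Q u] because [Q] is sunny. *)
Lemma resolvent_near_retraction (Q : E -> E) :
  sunny_nonexpansive_retraction C (fixed_points C T) Q ->
  forall e : R, 0 < e -> exists t z, [/\ 0 < t < 1, C z,
    z = t *: u + (1 - t) *: T z & `|z - Q u| < e].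
Proof.
move=> Q_snr; have [[QK _] _ _] := Q_snr.
set q := Q u.
have Fq : fixed_points C T q by rewrite -QK; exists u.
have [Cq Tq] := Fq.
(* The shift by 2 makes [t 0] strictly less than 1. *)
pose t n : R := n.+2%:R^-1.
have t01 n : 0 < t n < 1.
  by rewrite invr_gt0 ltr0n/= invf_lt1 ?ltr0n// ltr1n.
have t01W n : 0 < t n <= 1 by have /andP[-> /ltW] := t01 n.
have /choice[z hz] : forall n, exists z, C z /\ z = t n *: u + (1 - t n) *: T z.
  move=> n.
  have [z Cz zE] := resolvent_exists C_closed C_convex T_self T_ne Cu (t01W n).
  by exists z.
have Cz n : C (z n) := (hz n).1.
have zq n : `|z n - q| <= `|u - q|.
  have := resolvent_expansive T_ne Fq (Cz n) (t01W n) (hz n).2 ltr01.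
  by have := ler_normD (z n - q) (u - q); rewrite scale1r; lra.
have zT n : `|z n - T (z n)| <= t n * (2 * `|u - q|).
  have -> : z n - T (z n) = t n *: (u - T (z n)).
    rewrite [X in X - _](hz n).2 scalerBl scale1r scalerBr.
    by rewrite -addrA addrAC subrr add0r.
  rewrite normrZ gtr0_norm; last by have /andP[] := t01 n.
  rewrite ler_wpM2l//; first by have /andP[/ltW] := t01 n.
  have := ler_distD q u (T (z n)); have := zq n.
  have := T_ne Cq (Cz n); rewrite Tq (distrC q (z n)); lra.
have zT0 k : 0 < k -> \forall n \near \oo, `|z n - T (z n)| <= k.
  move=> k0; have k'0 : 0 < k / (2 * `|u - q| + 1).
    by rewrite divr_gt0// ltr_wpDl// mulr_ge0.
  near=> n; apply: le_trans (zT n) _.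
  have tk : t n <= k / (2 * `|u - q| + 1).
    apply: (@le_trans _ _ n.+1%:R^-1); first by rewrite lef_pV2 ?posrE ?ltr0n// ler_nat.
    by apply/ltW; near: n; exact: (near_infty_natSinv_lt (PosNum k'0)).
  move: tk; rewrite ler_pdivlMr; last by rewrite ltr_wpDl// mulr_ge0.
  by have /andP[] := t01 n; lra.
have zbnd : \forall n \near \oo, `|z n - q| <= `|u - q| by near=> n.
have [rho [p [Cp zp zmin zuniq]]] := asymptotic_center E_uc C_closed C_convex Cq zbnd.
(* As [z n - T (z n)] tends to 0, [T p] is an asymptotic center too. *)
have Tp : T p = p.
  apply: zuniq => [|k k0]; first exact: T_self.
  have k20 : 0 < k / 2 by lra.
  near=> n.
  have h1 : `|z n - T (z n)| <= k / 2 by near: n; exact: zT0.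
  have h2 : `|z n - p| <= rho + k / 2 by near: n; exact: zp.
  have := ler_distD (T (z n)) (z n) (T p).
  have := T_ne (Cz n) Cp; lra.
have Fp : fixed_points C T p by [].
have rho0 : 0 <= rho.
  apply/ler_addgt0Pr => k k0; have [n] := filter_ex (zp k k0).
  by apply: le_trans.
(* Minimality of [p] against [p + s *: (u - p)] makes the backward quotient at some [z n - p] small;
   by smoothness the forward one is small as well, yet [resolvent_expansive] makes it at least 2|z n
   - p|^2. *)
have cluster e : 0 < e -> exists n, `|z n - p| < e.
  move=> e0; pose M := rho + 1.
  have M0 : 0 < M by rewrite ltr_wpDl.
  have e20 : 0 < e ^+ 2 / 2 by rewrite divr_gt0// exprn_gt0.
  have [s /andP[s0 s1] hs] := uniformly_gateaux_sqr E_ug (u - p) M0 e20.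
  pose k := Num.min 1 (s * (e ^+ 2 / 2) / (4 * M)).
  have k0 : 0 < k by rewrite lt_min ltr01/= divr_gt0 ?mulr_gt0.
  have k1 : k <= 1 by rewrite ge_min lexx.
  have kM : 4 * M * k <= s * (e ^+ 2 / 2).
    by rewrite mulrC -ler_pdivlMr ?mulr_gt0// ge_min lexx orbT.
  have Cy : C (s *: u + (1 - s) *: p).
    by move/convex_setP : C_convex; apply => //; rewrite ltW.
  have [n zpn zyn] : exists2 n, `|z n - p| <= rho + k
      & rho - k < `|z n - (s *: u + (1 - s) *: p)|.
    apply: contrapT => nex; apply: (zmin _ (rho - k) Cy); first lra.
    near=> n; rewrite leNgt; apply/negP => zyn; apply: nex.
    by exists n => //; near: n; exact: zp.
  exists n; move: zyn.
  have -> : z n - (s *: u + (1 - s) *: p) = z n - p - s *: (u - p).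
    by rewrite -[RHS]addrA -opprD scalerBl scale1r scalerBr addrCA.
  have := resolvent_expansive T_ne Fp (Cz n) (t01W n) (hz n).2 s0.
  have := hs (z n - p) _.
  set a := `|z n - p| in zpn *; set b := `|_ + _|; set c := `|_ - _ *: _|.
  have a0 : 0 <= a by exact: normr_ge0.
  have c0 : 0 <= c by exact: normr_ge0.
  move=> /(_ ltac:(rewrite /M; lra)) habc hab hc.
  have hab2 : ((1 + s) * a) ^+ 2 <= b ^+ 2.
    by rewrite ler_sqr ?nnegrE//; [apply: mulr_ge0 => //; lra|exact: normr_ge0].
  have hac : a ^+ 2 - c ^+ 2 <= 4 * M * k.
    rewrite subr_sqr; have aM : a <= M by rewrite /M; lra.
    have [ac|ca] := leP a c.
      apply: (@le_trans _ _ 0); last by rewrite !mulr_ge0// ltW.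
      by apply: mulr_le0_ge0; lra.
    have -> : 4 * M * k = (2 * k) * (2 * M) by ring.
    by apply: ler_pM; lra.
  have : s * (2 * a ^+ 2) <= s * e ^+ 2.
    have : 0 <= s ^+ 2 * a ^+ 2 by rewrite mulr_ge0 ?sqr_ge0.
    nra.
  rewrite ler_pM2l// => ae.
  rewrite -(@ltr_pXn2r _ 2) ?nnegrE// ?ltW//.
  have : 0 < e ^+ 2 by rewrite exprn_gt0.
  lra.
suff pq : p = q.
  move=> e e0; have [n ne] := cluster e e0.
  by exists (t n), (z n); split => //; [exact: (hz n).2|rewrite -pq].
apply/eqP; rewrite -subr_eq0 -normr_eq0; apply/negPn/negP => pq0.
set v := p - q in pq0; set w := u - q.
have v0 : 0 < `|v| by rewrite lt0r pq0 normr_ge0.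
(* With the error [e] taken as |v|^2, smoothness, [hsunny] and [hexp] together give (2s + s^2)|v|^2
   <= s|v|^2, which is absurd. [hexp] passes from the resolvents to their cluster point [p]. *)
have [s /andP[s0 s1] hs] := uniformly_gateaux_sqr E_ug w v0 (exprn_gt0 2 v0).
have hsunny := sunny_variational C_convex (fun x => @proj1 _ _) Q_snr Cu Fp
  (introT andP (conj (ltW s0) s1)).
have hexp : (1 + s) * `|v| <= `|v + s *: w|.
  apply/ler_addgt0Pr => e e0.
  have e30 : 0 < e / 3 by lra.
  have [n zpn] := cluster _ e30.
  have h := resolvent_expansive T_ne Fq (Cz n) (t01W n) (hz n).2 s0.
  have h1 : `|z n - q + s *: w| <= `|v + s *: w| + `|z n - p|.
    have -> : z n - q + s *: w = (v + s *: w) + (z n - p).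
      by rewrite /v [RHS]addrC addrA addrA subrK.
    exact: ler_normD.
  have h2 : `|v| <= `|z n - q| + `|z n - p|.
    by have := ler_distD (z n) p q; rewrite (distrC p (z n)) -/v; lra.
  have := ler_wpM2l (ltW s0) h2; have := ler_wpM2l (ltW s0) (ltW zpn).
  rewrite -/w in h; nra.
have := hs v (lexx _).
rewrite -/q -/v -/w in hsunny.
have := ler_pM _ _ hsunny hsunny; rewrite -!expr2 => /(_ (ltW v0) (ltW v0)).
have := ler_pM _ _ hexp hexp; rewrite -!expr2 => /(_ ltac:(nra) ltac:(nra)).
have : 0 < s * `|v| ^+ 2 by rewrite mulr_gt0// exprn_gt0.
have : 0 <= s ^+ 2 * `|v| ^+ 2 by rewrite mulr_ge0 ?sqr_ge0.
nra.
Unshelve. all: by end_near. Qed.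
End retraction.

(** * The variational inequality at approximate fixed points *)

Lemma sqr_norm_diff_le (R : realType) (E : normedModType R) (x y : E) (B e : R) :
  `|x| <= B -> `|y| <= B -> `|x - y| <= e -> `|x| ^+ 2 - `|y| ^+ 2 <= 2 * B * e.
Proof.
move=> xB yB xye; have x0 := normr_ge0 x; have y0 := normr_ge0 y.
have e0 : 0 <= e := le_trans (normr_ge0 _) xye.
have := lerB_dist x y; rewrite subr_sqr => h.
have [xy|yx] := leP `|x| `|y|.
  apply: (@le_trans _ _ 0); last by rewrite !mulr_ge0//; lra.
  by apply: mulr_le0_ge0; lra.
by rewrite mulrC; apply: ler_pM; lra.
Qed.

(** For a resolvent [z] near [q], |x - T z| exceeds |x - z| by at most |x - T x|, so a forward
    quotient at [x - z] towards [u - z] is small. Convexity passes to the backward quotient with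
    step [s], [z] is replaced by [q], and smoothness returns to a forward quotient. *)
Lemma approx_fixed_variational (R : realType) (E : completeNormedModType R)
    (E_uc : uniformly_convex E)
    (E_ug : uniformly_gateaux_differentiable_norm E)
    (C : set E) (C_closed : closed C) (C_convex : convex_set C)
    (T : E -> E) (T_self : set_fun C C T) (T_ne : nonexpansive C T)
    (u : E) (Cu : C u) (Q : E -> E)
    (Q_snr : sunny_nonexpansive_retraction C (fixed_points C T) Q) (M e : R) :
  0 < M -> 0 < e -> exists s d, [/\ 0 < s, 0 < d & forall x, C x ->
    `|x - Q u| <= M -> `|x - T x| <= d ->
    `|x - Q u + s *: (u - Q u)| ^+ 2 <= `|x - Q u| ^+ 2 + s * e].
Proof.
move=> M0 e0; set q := Q u; set w := u - q.
(* One third each for smoothness, for replacing [z] by [q] (through [k]), and for |x - T x| (through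
   [d]). *)
have e30 : 0 < e / 3 by lra.
have [s /andP[s0 s1] hs] := uniformly_gateaux_sqr E_ug w M0 e30.
pose B := M + `|w| + 2.
have B0 : 0 < B by have := normr_ge0 w; rewrite /B; lra.
pose k := Num.min 1 (s * (e / 3) / (6 * B)).
have k0 : 0 < k by rewrite lt_min ltr01/= divr_gt0 ?mulr_gt0.
have k1 : k <= 1 by rewrite ge_min lexx.
have kB : 6 * B * k <= s * (e / 3).
  by rewrite mulrC -ler_pdivlMr ?mulr_gt0// ge_min lexx orbT.
have [t [z [/andP[t0 t1] Cz zE zq]]] := resolvent_near_retraction E_uc E_ug
  C_closed C_convex T_self T_ne Cu Q_snr k0.
rewrite -/q in zq.
have t10 : 0 < 1 - t by lra.
(* The equation for [z] reads [t *: (u - z) = (1 - t) *: (z - T z)], so this step leads from [x - z]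
   to [x - T z]. *)
pose s' := t / (1 - t).
have s'0 : 0 < s' by rewrite divr_gt0.
pose d := Num.min 1 (s' * (e / 3) / (2 * B)).
have d0 : 0 < d.
  by rewrite lt_min ltr01/=; apply: divr_gt0; apply: mulr_gt0.
have d1 : d <= 1 by rewrite ge_min lexx.
have dB : 2 * B * d <= s' * (e / 3).
  by rewrite mulrC -ler_pdivlMr ?mulr_gt0// ge_min lexx orbT.
exists s, d; split=> // x Cx xM xT.
have zqk : `|z - q| <= k := ltW zq.
have zTz : s' *: (u - z) = z - T z.
  apply: (@scalerI _ _ (1 - t)); first by rewrite gt_eqF.
  rewrite scalerA /s' mulrCA mulfV ?mulr1 ?gt_eqF// [in RHS]scalerBr.
  rewrite scalerBl scale1r [in X in _ = X - _ - _]zE scalerBr.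
  by rewrite addrAC addrK.
have xTz : x - z + s' *: (u - z) = x - T z by rewrite zTz addrA subrK.
have xz : `|x - z| <= B.
  by have := ler_distD q x z; rewrite (distrC q) /B; have := normr_ge0 w; lra.
have xTzB : `|x - T z| <= `|x - z| + d.
  by have := ler_distD (T x) x (T z); have := T_ne _ _ Cx Cz; lra.
have h1 : `|x - q| ^+ 2 - `|x - z| ^+ 2 <= 2 * B * k.
  apply: sqr_norm_diff_le => //; first by rewrite /B; have := normr_ge0 w; lra.
  by rewrite opprB addrC addrA subrK.
have nsw : `|s *: w| <= `|w| by rewrite normrZ gtr0_norm// ler_piMl.
have dist2 : `|(x - z - s *: (u - z)) - (x - q - s *: w)| <= 2 * k.
  have -> : x - z - s *: (u - z) - (x - q - s *: w) = s *: (z - q) - (z - q).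
    have -> : u - z = w - (z - q) by rewrite /w opprB addrA subrK.
    have -> : x - z = x - q - (z - q) by rewrite opprB addrA subrK.
    rewrite (scalerBr s w).
    move: (x - q) (s *: w) (z - q) (s *: (z - q)) => a b c g.
    rewrite !opprB -!addrA addKr.
    by rewrite [LHS]addrC !addrA subrK addrC.
  apply: le_trans (ler_normB _ _) _; rewrite normrZ gtr0_norm//.
  by have := ler_piMl (normr_ge0 (z - q)) s1; lra.
have h2 : `|x - z - s *: (u - z)| ^+ 2 - `|x - q - s *: w| ^+ 2 <= 2 * B * (2 * k).
  apply: sqr_norm_diff_le => //; apply: le_trans (ler_normB _ _) _.
    have : `|s *: (u - z)| <= `|u - z| by rewrite normrZ gtr0_norm// ler_piMl.
    have := ler_distD q u z; have := ler_distD q x z.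
    by rewrite (distrC q z) -/w /B; lra.
  by rewrite /B; lra.
have h3 : `|x - T z| ^+ 2 - `|x - z| ^+ 2 <= 2 * B * d.
  have xzM : `|x - z| <= M + 1 by have := ler_distD q x z; rewrite (distrC q z); lra.
  have := ler_pM (normr_ge0 _) (normr_ge0 _) xTzB xTzB; rewrite -!expr2.
  have := normr_ge0 w; have := ler_wpM2r (ltW d0) xzM; rewrite /B; nra.
have := hs _ xM.
have := norm_between_sqr (x - z) (u - z) s0 s'0; rewrite xTz => h4.
have : `|x - z| ^+ 2 - `|x - z - s *: (u - z)| ^+ 2 <= s * (e / 3).
  rewrite -(ler_pM2l s'0).
  by have := ler_wpM2l (ltW s0) (le_trans h3 dB); lra.
lra.
Qed.

(** * A real recursion, and approximate fixed points along the iteration *)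

Lemma bounded_fun_le (R : realType) (E : normedModType R) (I : Type)
    (f : I -> E) (M : R) :
  (forall i, `|f i| <= M) -> bounded_fun f.
Proof.
move=> fM; exists M; split; first exact: num_real.
by move=> M' MM' i _; apply: le_trans (ltW MM').
Qed.

(** While [a n] exceeds [2 * e], each step lowers it by at least [alpha n * e], which the divergent
    series forbids forever; once below [2 * e], the recursion keeps it there. *)
Lemma recursion_eventually_le (R : realType) (a alpha : nat -> R) (e : R) (N : nat) :
  0 < e -> (forall n, 0 <= a n) -> (forall n, 0 < alpha n <= 1) ->
  series alpha n @[n --> \oo] --> +oo ->
  (forall n, (N <= n)%N -> a n.+1 <= (1 - alpha n) * a n + alpha n * e) ->
  \forall n \near \oo, a n <= 2 * e.
Proof.
move=> e0 a0 al01 aldvg arec.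
have [m Nm am] : exists2 m, (N <= m)%N & a m <= 2 * e.
  apply: contrapT => nex.
  have big n : (N <= n)%N -> 2 * e < a n.
    by move=> Nn; rewrite ltNge; apply/negP => an; apply: nex; exists n.
  have dec k : a (N + k)%N <= a N - e * (series alpha (N + k)%N - series alpha N).
    elim: k => [|k IH]; first by rewrite addn0 subrr mulr0 subr0.
    rewrite addnS; apply: le_trans (arec _ (leq_addr _ _)) _.
    have := big _ (leq_addr k N); have /andP[al0 _] := al01 (N + k)%N.
    move=> /ltW /(ler_wpM2l (ltW al0)).
    rewrite [series alpha (N + k).+1]/series/= big_nat_recr//=.
    move: IH; rewrite /series/=; lra.
  have /cvgryPge/(_ (series alpha N + (a N + 1) / e)) := aldvg.
  move=> /(filterI (nbhs_infty_ge N)) /filter_ex[n [/= Nn]].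
  have := dec (n - N)%N; rewrite subnKC// => h.
  rewrite -lerBrDl ler_pdivrMr//.
  by have := a0 n; lra.
exists m => // n /= /subnKC <-; elim: (n - m)%N => [|k IH]; first by rewrite addn0.
rewrite addnS; apply: le_trans (arec _ (leq_trans Nm (leq_addr _ _))) _.
have /andP[al0 al1] := al01 (m + k)%N.
have : (1 - alpha (m + k)%N) * a (m + k)%N <= (1 - alpha (m + k)%N) * (2 * e).
  by rewrite ler_wpM2l//; lra.
have := mulr_gt0 al0 e0; lra.
Qed.

(** By contradiction: along bad indices with vanishing defect, strong nonexpansiveness against the
    constant [q] forces x - S x to 0, and the NST condition then forces x - T x to 0. *)
Lemma strongly_nonexpansive_approx (R : realType) (E : normedModType R)
    (C : set E) (S : nat -> E -> E) (T : E -> E) (x : nat -> E) (q : E) (M : R) :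
  strongly_nonexpansive_sequence C S -> NST_condition_I C S T ->
  common_fixed_points C S q -> (forall n, C (x n)) ->
  (forall n, `|x n - q| <= M) ->
  forall d, 0 < d -> exists eta N, 0 < eta /\ forall n, (N <= n)%N ->
    `|x n - q| - `|S n (x n) - q| < eta ->
    `|x n - S n (x n)| + `|x n - T (x n)| < d.
Proof.
move=> [Sne Ssne] [_ _ nst] Fq Cx xM d d0.
have Sq n : S n q = q by have [] := Fq n I.
have Cq : C q by have [] := Fq 0%N I.
apply: contrapT => nex.
have /choice[nk hnk] : forall k, exists n, [/\ (k <= n)%N,
    `|x n - q| - `|S n (x n) - q| < k.+1%:R^-1 &
    d <= `|x n - S n (x n)| + `|x n - T (x n)|].
  move=> k; apply: contrapT => nexk; apply: nex.
  exists k.+1%:R^-1, k; split; first by rewrite invr_gt0.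
  move=> n kn hn; rewrite ltNge; apply/negP => dn; apply: nexk.
  by exists n.
(* A sequence equal to [q] off the bad indices stands for a subsequence, which
   the hypotheses do not allow because [S n] must be paired with the index [n]. *)
pose y n := if `[< range nk n >] then x n else q.
have ynk k : y (nk k) = x (nk k) by rewrite /y asboolT.
have yP n : y n = q \/ exists2 k, n = nk k & y n = x n.
  by rewrite /y; case: asboolP => [[k _ <-]|_]; [right; exists k|left].
have Cy n : C (y n) by have [->//|[k _ ->]] := yP n.
have yM n : `|y n - q| <= M.
  by have [->|[k _ ->]//] := yP n; rewrite subrr normr0; apply: le_trans (xM n).
have ySy : y n - S n (y n) @[n --> \oo] --> (0 : E).
  have -> : (fun n => y n - S n (y n)) = (fun n => y n - q - (S n (y n) - S n q)).
    by apply/funext => n; rewrite Sq opprB addrA subrK.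
  apply: Ssne => //; first exact: (@bounded_fun_le _ _ _ _ M).
  apply/cvgrPdist_le => e e0.
  have [K _ HK] := near_infty_natSinv_lt (PosNum e0).
  (* [nk] need not be monotone: beyond this maximum, [n = nk k] implies [K <= k]. *)
  exists (\max_(i < K) nk i).+1 => // n /= Kn.
  rewrite sub0r normrN Sq ger0_norm; last first.
    by rewrite subr_ge0 -[in leLHS](Sq n); exact: Sne.
  have [->|[k nkn ->]] := yP n; first by rewrite Sq subrr ltW.
  have [kK|Kk] := ltnP k K.
    by move: Kn; rewrite nkn ltnNge (leq_bigmax (Ordinal kK)).
  have [_ h _] := hnk k; rewrite nkn.
  by apply: (le_trans (ltW h)); exact/ltW/HK.
have yb : bounded_fun y.
  apply: (@bounded_fun_le _ _ _ _ (M + `|q|)) => n.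
  by rewrite -[y n](subrK q); apply: le_trans (ler_normD _ _) _; rewrite lerD2r.
have yTy := nst y Cy yb ySy.
have d20 : 0 < d / 2 by lra.
have := filterI ((cvgrPdist_lt _ _).1 ySy _ d20) ((cvgrPdist_lt _ _).1 yTy _ d20).
move=> [N _ HN].
have [Nk _] := hnk N; have [] := HN (nk N) Nk; rewrite !sub0r !normrN ynk; lra.
Qed.

(** * Convergence of the iteration *)

Theorem corollary3p4 (R : realType) (E : completeNormedModType R)
    (E_uc : uniformly_convex E)
    (E_ug : uniformly_gateaux_differentiable_norm E)
    (C : set E) (C_neq0 : C !=set0) (C_closed : closed C)
    (C_convex : convex_set C)
    (S : nat -> E -> E) (S_self : forall n, set_fun C C (S n))
    (T : E -> E) (T_self : set_fun C C T) (T_ne : nonexpansive C T)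
    (alpha : nat -> R) (alpha_01 : forall n, 0 < alpha n <= 1)
    (u : E) (Cu : C u)
    (x : nat -> E) (Cx0 : C (x 0%N))
    (x_rec : forall n, x n.+1 = alpha n *: u + (1 - alpha n) *: S n (x n))
    (alpha_cvg0 : alpha n @[n --> \oo] --> (0 : R))
    (alpha_dvg : series alpha n @[n --> \oo] --> +oo)
    (S_sne : strongly_nonexpansive_sequence C S)
    (ST_nst : NST_condition_I C S T)
    (Q : E -> E) (Q_snr : sunny_nonexpansive_retraction C (fixed_points C T) Q) :
  x n @[n --> \oo] --> Q u.
Proof.
have [[QK _] _ _] := Q_snr.
set q := Q u; set w := u - q.
have Fq : fixed_points C T q by rewrite -QK; exists u.
have [_ FTS _] := ST_nst; have [Sne _] := S_sne; have [Cq Tq] := Fq.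
have FSq := FTS _ Fq.
have Sq n : S n q = q by have [] := FSq n I.
have al_ge0 n : 0 <= alpha n by have /andP[/ltW] := alpha_01 n.
have al_le1 n : 0 <= 1 - alpha n by have /andP[_] := alpha_01 n; rewrite subr_ge0.
have Cx n : C (x n).
  elim: n => // n IH; rewrite x_rec; move/convex_setP : C_convex; apply => //.
    exact: S_self.
  by have /andP[/ltW-> ->] := alpha_01 n.
have Sxq n : `|S n (x n) - q| <= `|x n - q| by rewrite -[in leLHS](Sq n) Sne.
have xqE n : x n.+1 - q = alpha n *: w + (1 - alpha n) *: (S n (x n) - q).
  rewrite x_rec /w !scalerBr addrACA -opprD -scalerDl.
  by rewrite subrKC scale1r.
have xq_le n : `|x n.+1 - q| <= alpha n * `|w| + (1 - alpha n) * `|S n (x n) - q|.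
  by rewrite xqE; apply: le_trans (ler_normD _ _) _; rewrite !normrZ !ger0_norm.
pose M := `|x 0%N - q| + `|w| + 1.
have wM : `|w| <= M by have := normr_ge0 (x 0%N - q); rewrite /M; lra.
have M0 : 0 < M by have := normr_ge0 (x 0%N - q); have := normr_ge0 w; rewrite /M; lra.
have xM n : `|x n - q| <= M.
  elim: n => [|n IH]; first by have := normr_ge0 w; rewrite /M; lra.
  have := ler_wpM2l (al_ge0 n) wM.
  have := ler_wpM2l (al_le1 n) (le_trans (Sxq n) IH).
  by have := xq_le n; lra.
apply/cvgrPdistC_le => e e0.
have e20 : 0 < e ^+ 2 / 2 by rewrite divr_gt0 ?exprn_gt0.
have [s [d [s0 d0 hsd]]] := approx_fixed_variational E_uc E_ug C_closed C_convex
  T_self T_ne Cu Q_snr M0 e20.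
rewrite -/q -/w in hsd.
have d60 : 0 < d / 6 by lra.
have [eta [N1 [eta0 hN1]]] :=
  strongly_nonexpansive_approx S_sne ST_nst FSq Cx xM d60.
(* The three bounds on [alpha n] serve, in order, to make [x n.+1] an approximate fixed point, to
   keep half of the gap [eta], and to let the drop of the square absorb [alpha n * M ^+ 2]. *)
pose r := Num.min (d / (8 * M)) (Num.min (eta / (2 * M)) (eta ^+ 2 / (2 * M ^+ 2))).
have r0 : 0 < r by rewrite !lt_min; do ![apply/andP; split];
  apply: divr_gt0; rewrite ?mulr_gt0 ?exprn_gt0.
have [N2 _ hN2] := (cvgrPdist_le _ _).1 alpha_cvg0 r r0.
have small n : (N2 <= n)%N -> [/\ alpha n * (8 * M) <= d, alpha n * (2 * M) <= eta &
    alpha n * (2 * M ^+ 2) <= eta ^+ 2].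
  move=> /hN2 /=; rewrite sub0r normrN ger0_norm// !le_min => /and3P[].
  by rewrite !ler_pdivlMr ?mulr_gt0 ?exprn_gt0//; split.
have rec n : (maxn N1 N2 <= n)%N ->
    `|x n.+1 - q| ^+ 2 <= (1 - alpha n) * `|x n - q| ^+ 2 + alpha n * (e ^+ 2 / 2).
  rewrite geq_max => /andP[/hN1 approx /small[ald aleta aleta2]].
  have al0 : 0 < alpha n by have /andP[] := alpha_01 n.
  have D0 := normr_ge0 (x n - q); have D'0 := normr_ge0 (x n.+1 - q).
  have F0 := normr_ge0 (S n (x n) - q).
  have DM := xM n; have FD := Sxq n.
  have [/approx xapp|gap] := ltP (`|x n - q| - `|S n (x n) - q|) eta; last first.
    (* Here |x n - q| is at least [eta], so its square drops by at least 3/4 of [eta ^+ 2]. *)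
    have D'D : `|x n.+1 - q| <= `|x n - q| - eta / 2.
      have := ler_wpM2l (al_ge0 n) wM; have := mulr_ge0 (al_ge0 n) F0.
      by have := xq_le n; lra.
    have := ler_pM D'0 D'0 D'D D'D; rewrite -!expr2.
    have : alpha n * `|x n - q| ^+ 2 <= alpha n * M ^+ 2.
      by rewrite ler_wpM2l// lerXn2r ?nnegrE// ltW.
    have := mulr_ge0 (al_ge0 n) (ltW e20).
    have : eta * eta <= eta * `|x n - q| by rewrite ler_pM2l//; lra.
    by rewrite expr2; nra.
  have step : `|x n.+1 - x n| <= alpha n * (2 * M) + `|x n - S n (x n)|.
    have -> : x n.+1 - x n = alpha n *: (u - S n (x n)) - (x n - S n (x n)).
      rewrite x_rec scalerBr scalerBl scale1r opprB.
      by rewrite !addrA; congr (_ - _); rewrite addrAC.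
    apply: le_trans (ler_normB _ _) _; rewrite lerD2r normrZ ger0_norm//.
    rewrite ler_wpM2l//.
    have := ler_distD q u (S n (x n)); rewrite (distrC q) -/w; lra.
  (* Twice the step plus |x n - T (x n)|: at most [d / 2] from [alpha n] and [2 * (d / 6)] from
     [xapp]. *)
  have xT : `|x n.+1 - T (x n.+1)| <= d.
    have := ler_distD (x n) (x n.+1) (T (x n.+1)).
    have := ler_distD (T (x n)) (x n) (T (x n.+1)).
    have := T_ne _ _ (Cx n) (Cx n.+1); rewrite (distrC (x n) (x n.+1)).
    have := normr_ge0 (x n - S n (x n)); have := normr_ge0 (x n - T (x n)).
    lra.
  have h1 := hsd _ (Cx n.+1) (xM n.+1) xT.
  (* The backward quotient with step [alpha n] reaches [(1 - alpha n) *: (S n (x n) - q)], and [h1]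
     bounds the forward one with step [s]. *)
  have := norm_between_sqr (x n.+1 - q) w al0 s0.
  have -> : x n.+1 - q - alpha n *: w = (1 - alpha n) *: (S n (x n) - q).
    by rewrite xqE addrAC subrr add0r.
  rewrite normrZ ger0_norm// exprMn => h2.
  have h3 : (1 - alpha n) ^+ 2 * `|S n (x n) - q| ^+ 2 <= (1 - alpha n) * `|x n - q| ^+ 2.
    rewrite expr2 -mulrA ler_wpM2l//.
    apply: (@le_trans _ _ (1 * `|x n - q| ^+ 2)); last by rewrite mul1r.
    by apply: ler_pM; rewrite ?sqr_ge0//; [lra|rewrite lerXn2r ?nnegrE].
  rewrite -(ler_pM2l s0).
  have := ler_wpM2l (ltW s0) h3; have := ler_wpM2l (al_ge0 n) h1.
  lra.
have := recursion_eventually_le e20 (fun n => sqr_ge0 `|x n - q|) alpha_01 alpha_dvg rec.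
apply: filterS => n.
rewrite mulrC divfK ?pnatr_eq0// => h.
by rewrite -(@ler_pXn2r _ 2) ?nnegrE// ltW.
Qed.
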